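(* Let $N\in\mathbb{N}$, $N\ge 1$, let $F_N=\langle g_1,\dots,g_N\rangle$ be the free group on $N$ generators, let $\tau$ be the canonical trace on $L(F_N)$, and let $G=g_1+\cdots+g_N+g_1^{-1}+\cdots+g_N^{-1}\in L(F_N)$. Then for all $n\in\mathbb{N}$, $n\ge 1$, $$\tau(G^n)=\begin{cases}0 & \text{if } n \text{ is odd},\\ p_0^{n} & \text{if } n\text{ is even},\end{cases}$$ where the numbers $p_0^{n}$ ($n$ even) are those defined by the recurrence in the context.
   Context: $L(F_N)=\overline{\mathbb{C}[F_N]}^{w}$ is the group von Neumann algebra of $F_N$, with group elements identified with the corresponding unitaries; the canonical trace is $\tau\left(\sum_{g\in F_N}t_g g\right)=t_e$, where $e$ is the identity of $F_N$. The numbers $p_{j}^{2k}$ ($j$ even, $0\le j\le 2k-2$) and $q_{i}^{2k+1}$ ($i$ odd, $1\le i\le 2k-1$) are defined recursively (the ''recurrence diagram for $N$'') by $p_0^2=2N$, $q_1^3=(2N-1)+2N$, and for every $k\ge 2$: $p_{2k-2}^{2k}=(2N-1)+q_{2k-3}^{2k-1}$; $\;p_{2i}^{2k}=(2N-1)\,q_{2i+1}^{2k-1}+q_{2i-1}^{2k-1}$ for $1\le i\le k-2$; $\;p_0^{2k}=(2N)\,q_1^{2k-1}$; $q_{2k-1}^{2k+1}=(2N-1)+p_{2k-2}^{2k}$; $\;q_{2i+1}^{2k+1}=(2N-1)\,p_{2i+2}^{2k}+p_{2i}^{2k}$ for $0\le i\le k-2$. Superscripts on $p$ and $q$ are indices,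 not exponents. *)

(* Defs.v *)
From HB Require Import structures.
From mathcomp Require Import all_boot all_order all_algebra.
From mathcomp Require Import all_classical all_reals all_analysis.
From mathcomp Require Import complex.
From mathcomp Require Import zify ring lra.

Set Implicit Arguments.
Unset Strict Implicit.
Unset Printing Implicit Defensive.

Import Order.TTheory GRing.Theory Num.Theory.

(* [(i, false)] stands for the generator [g_i], [(i, true)] for its inverse. *)
Notation letter N := ('I_N * bool)%type.

Definition linv N (a : letter N) : letter N := (a.1, ~~ a.2).

Definition reduced N (w : seq (letter N)) : bool :=
  sorted (fun a b => b != linv a) w.

Record freeGroup (N : nat) :=
  FreeGroup { word : seq (letter N); wordP : reduced word }.

HB.instance Definition _ N := [isSub for @word N].
HB.instance Definition _ N := [Choice of freeGroup N by <:].

Section FreeGroup.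
Variable N : nat.
Implicit Types (a b : letter N) (w : seq (letter N)) (u v : freeGroup N).

Lemma linvK : involutive (@linv N).
Proof. by move=> [i b]; rewrite /linv /= negbK. Qed.

Lemma linv_neq a : a != linv a.
Proof. by case: a => i b; rewrite xpair_eqE eqxx /=; case: b. Qed.

Definition lact a w : seq (letter N) :=
  if w is b :: w' then (if b == linv a then w' else a :: w) else [:: a].

Lemma lact_reduced a w : reduced w -> reduced (lact a w).
Proof.
case: w => [//|b w] rw; rewrite /lact; case: ifPn => [_|ba].
  exact: path_sorted rw.
by rewrite /reduced /= ba.
Qed.

Lemma lactK a w : reduced w -> lact a (lact (linv a) w) = w.
Proof.
case: w => [|b w] /=; first by rewrite eqxx.
rewrite linvK; case: (eqVneq b a) => [->|ba _] /=; last by rewrite eqxx.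
by case: w => [//|c w] /= /andP[/negPf -> _].
Qed.

Lemma lactKV a w : reduced w -> lact (linv a) (lact a w) = w.
Proof. by move=> rw; rewrite -{2}(linvK a) lactK. Qed.

Definition wmul (w w' : seq (letter N)) := foldr lact w' w.

Lemma wmul_reduced w w' : reduced w' -> reduced (wmul w w').
Proof. by move=> rw'; elim: w => //= a w /lact_reduced. Qed.

Lemma wmul0 w : reduced w -> wmul w [::] = w.
Proof.
elim: w => //= a w IH rw; rewrite IH; last exact: path_sorted rw.
by case: w rw {IH} => //= b w /andP[/negPf -> _].
Qed.

Lemma wmul_lact a w w' : reduced w' ->
  wmul (lact a w) w' = lact a (wmul w w').
Proof.
case: w => [//|b w] rw' /=; case: eqVneq => [->|//].
by rewrite lactK // wmul_reduced.
Qed.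

Lemma wmulA w1 w2 w3 : reduced w3 ->
  wmul w1 (wmul w2 w3) = wmul (wmul w1 w2) w3.
Proof. by move=> rw3; elim: w1 => //= a w1 IH; rewrite wmul_lact // IH. Qed.

Definition winv w := rev (map (@linv N) w).

Lemma winv_reduced w : reduced w -> reduced (winv w).
Proof.
move=> rw; rewrite /reduced /winv rev_sorted sorted_map.
by apply: sub_sorted rw => a b /=; rewrite linvK eq_sym.
Qed.

Lemma winvK : involutive winv.
Proof. by move=> w; rewrite /winv map_rev revK mapK //; exact: linvK. Qed.

Lemma wmulV w : wmul (winv w) w = [::].
Proof.
elim: w => //= a w IH; rewrite /winv /= rev_cons /wmul foldr_rcons /=.
by rewrite linvK eqxx.
Qed.

Definition fg_one : freeGroup N := @FreeGroup N [::] isT.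
Definition fg_mul u v : freeGroup N :=
  FreeGroup (wmul_reduced (word u) (wordP v)).
Definition fg_inv u : freeGroup N := FreeGroup (winv_reduced (wordP u)).

Lemma fg_mulA : associative fg_mul.
Proof. by move=> u v x; apply: val_inj; rewrite /= wmulA // wordP. Qed.
Lemma fg_mul1 : left_id fg_one fg_mul.
Proof. by move=> u; apply: val_inj. Qed.
Lemma fg_1mul : right_id fg_one fg_mul.
Proof. by move=> u; apply: val_inj; rewrite /= wmul0 // wordP. Qed.
Lemma fg_mulV : left_inverse fg_one fg_inv fg_mul.
Proof. by move=> u; apply: val_inj; rewrite /= wmulV. Qed.
Lemma fg_Vmul : right_inverse fg_one fg_inv fg_mul.
Proof.
by move=> u; apply: val_inj; rewrite /= -{1}[word u]winvK wmulV.
Qed.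

HB.instance Definition _ :=
  isGroup.Build (freeGroup N) fg_mulA fg_mul1 fg_1mul fg_mulV fg_Vmul.

Definition fg_gen (i : 'I_N) : freeGroup N := @FreeGroup N [:: (i, false)] isT.

Local Open Scope group_scope.

Lemma fg_cons a w (raw : reduced (a :: w)) :
  FreeGroup raw = (if a.2 then (fg_gen a.1)^-1 else fg_gen a.1)
                    * FreeGroup (path_sorted raw : reduced w).
Proof.
apply: val_inj; case: a raw => i [] raw /=;
by case: w raw => //= b w /andP[/negPf ba _]; rewrite ba.
Qed.

Lemma fg_universal (H : groupType) (f : 'I_N -> H) :
  exists! phi : freeGroup N -> H,
    {morph phi : x y / x * y} /\ forall i, phi (fg_gen i) = f i.
Proof.
pose fl a : H := if a.2 then (f a.1)^-1 else f a.1.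
pose fw w : H := foldr (fun a h => fl a * h) 1 w.
have flV a : fl a * fl (linv a) = 1.
  by case: a => i []; rewrite /fl /= ?mulVg ?mulgV.
have fwL a w : fw (lact a w) = fl a * fw w.
  case: w => [//|b w] /=; case: eqVneq => [->|//].
  by rewrite mulgA flV mul1g.
exists (fun u => fw (word u)); split.
  split=> [u v|i] /=; last by rewrite /fw /= mulg1.
  elim: (word u) => /= [|a w IH]; first by rewrite mul1g.
  by rewrite fwL IH mulgA.
move=> psi [psiM psig]; apply/funext => -[w rw] /=.
have psi1 : psi 1 = 1 by apply: (@mulgI _ (psi 1)); rewrite -psiM !mulg1.
have psiV x : psi x^-1 = (psi x)^-1.
  by apply: (@mulgI _ (psi x)); rewrite -psiM !mulgV.
elim: w rw => [|a w IH] rw.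
  by rewrite /= -psi1; congr psi; apply: val_inj.
rewrite fg_cons psiM -IH /= /fl; congr (_ * _).
by case: a.2; rewrite ?psiV psig.
Qed.

End FreeGroup.

Local Open Scope classical_set_scope.
Local Open Scope ring_scope.
Local Open Scope complex_scope.


Section Sums.
Variables (R : realType) (T : choiceType).
Implicit Types (a b : T -> R) (z : T -> R[i]).

(* [rsum a] is the sum of the family [a] when it is absolutely summable (the
   value is irrelevant otherwise); [csum] is its complex counterpart. *)
Definition rsum a : R :=
  fine (\esum_(t in [set: T]) (EFin \o a)^\+ t
        - \esum_(t in [set: T]) (EFin \o a)^\- t)%E.

Definition csum z : R[i] :=
  rsum (fun t => complex.Re (z t)) +i* rsum (fun t => complex.Im (z t)).

Definition rsummable a := summable [set: T] (EFin \o a).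

Definition csummable z :=
  rsummable (fun t => complex.Re (z t)) /\ rsummable (fun t => complex.Im (z t)).

Lemma rsummable_le a b : (forall t, `|a t| <= b t) ->
  rsummable b -> rsummable a.
Proof.
move=> ab; apply: le_lt_trans; apply: le_esum => t _ /=.
by rewrite lee_fin (le_trans (ab t)) // ler_norm.
Qed.

Lemma rsumD a b : rsummable a -> rsummable b ->
  rsum (fun t => a t + b t) = rsum a + rsum b.
Proof.
move=> sa sb; rewrite /rsum.
set f := fun t => ((EFin \o a)^\+ t + (EFin \o b)^\+ t)%E.
set g := fun t => ((EFin \o a)^\- t + (EFin \o b)^\- t)%E.
have sf : summable [set: T] f.
  by apply: summableD; exact: summable_funepos.
have sg : summable [set: T] g.
  by apply: summableD; exact: summable_funeneg.
have fgE : EFin \o (fun t => a t + b t) = (f \- g)%E.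
  exact: (funeD_posD (EFin \o a) (EFin \o b)).
have fin (h : T -> \bar R) : summable [set: T] h ->
    (\esum_(t in [set: T]) h^\+ t)%E \is a fin_num /\
    (\esum_(t in [set: T]) h^\- t)%E \is a fin_num.
  move=> sh; split; (rewrite ge0_fin_numE; last by apply: esum_ge0);
    apply: le_lt_trans sh; apply: le_esum => t _;
    rewrite -/((abse \o h) t) fune_abse /=; [exact: leeDl|exact: leeDr].
have [ap an] := fin _ sa.
have [bp bn] := fin _ sb.
rewrite fgE esumB //; first last.
- by move=> t _; rewrite adde_ge0.
- by move=> t _; rewrite adde_ge0.
rewrite /f /g !esumD // !fineB ?fin_numD ?ap ?an ?bp ?bn // !fineD //.
by lra.
Qed.

Lemma csumD z1 z2 : csummable z1 -> csummable z2 ->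
  csum (fun t => z1 t + z2 t) = csum z1 + csum z2.
Proof.
move=> [r1 i1] [r2 i2]; rewrite /csum.
apply/eqP; rewrite eq_complex /=; apply/andP; split; apply/eqP.
- by rewrite -rsumD //; congr rsum; apply/funext => t; case: (z1 t) (z2 t) => ? ? [].
- by rewrite -rsumD //; congr rsum; apply/funext => t; case: (z1 t) (z2 t) => ? ? [].
Qed.

Lemma rsum_reindex (e : T -> T) a : bijective e ->
  rsum (fun t => a (e t)) = rsum a.
Proof.
rewrite -setTT_bijective => be; rewrite /rsum.
congr (fine (_ - _)%E); rewrite [RHS](reindex_esum _ _ _ _ be);
  by apply: eq_esum => t _; rewrite ?funeposE ?funenegE.
Qed.

Lemma csum_reindex (e : T -> T) z : bijective e ->
  csum (fun t => z (e t)) = csum z.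
Proof.
move=> be; rewrite /csum.
rewrite (rsum_reindex (fun t => complex.Re (z t)) be).
by rewrite (rsum_reindex (fun t => complex.Im (z t)) be).
Qed.

Lemma csum0 : csum (fun=> 0) = 0.
Proof.
have rsum0 : rsum (fun=> 0) = 0.
  rewrite /rsum !esum1 ?sube0 // => t _.
    by rewrite funenegE /= oppr0 maxxx.
  by rewrite funeposE /= maxxx.
by rewrite /csum /= rsum0.
Qed.

End Sums.

Section L2.
Variables (R : realType) (T : choiceType).

Definition sqmod (z : R[i]) : R := complex.Re z ^+ 2 + complex.Im z ^+ 2.

Lemma sqmodE z : (sqmod z)%:C = `|z| ^+ 2.
Proof. exact: add_Re2_Im2. Qed.

Lemma sqmod_ge0 z : 0 <= sqmod z.
Proof. by rewrite addr_ge0 // sqr_ge0. Qed.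

Lemma sqmodM y z : sqmod (y * z) = sqmod y * sqmod z.
Proof. by case: y z => ? ? [] ? ?; rewrite /sqmod /=; ring. Qed.

Lemma sqmodD y z : sqmod (y + z) <= 2 * sqmod y + 2 * sqmod z.
Proof.
case: y z => a b [c d]; rewrite /sqmod /=.
by have := sqr_ge0 (a - c); have := sqr_ge0 (b - d); nra.
Qed.

Definition l2sum (x : T -> R[i]) : \bar R :=
  (\esum_(t in [set: T]) (sqmod (x t))%:E)%E.

Definition l2_pred : {pred T -> R[i]} := [pred x | `[< (l2sum x < +oo)%E >]].

Lemma l2sum_ge0 x : (0 <= l2sum x)%E.
Proof. by apply: esum_ge0 => t _; rewrite lee_fin sqmod_ge0. Qed.

Lemma l2sum_lin (c : R[i]) (x y : T -> R[i]) :
  (l2sum (fun t => c * x t + y t)%R <=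
     (2 * sqmod c)%:E * l2sum x + 2%:E * l2sum y)%E.
Proof.
have esumZ k (f : T -> R) : 0 <= k -> (forall t, 0 <= f t) ->
    (\esum_(t in [set: T]) (k * f t)%:E <=
       k%:E * \esum_(t in [set: T]) (f t)%:E)%E.
  move=> k0 f0; apply: ge_ereal_sup => _ [A [fA AT] <-].
  under eq_fsbigr do rewrite EFinM.
  rewrite -ge0_mule_fsumr; last by move=> t; rewrite lee_fin.
  rewrite lee_wpmul2l ?lee_fin //; apply: ereal_sup_ubound.
  by exists A.
have k0 : 0 <= 2 * sqmod c by rewrite mulr_ge0 // sqmod_ge0.
apply: (@le_trans _ _ (\esum_(t in [set: T])
    ((2 * sqmod c * sqmod (x t))%:E + (2 * sqmod (y t))%:E)))%E.
  apply: le_esum => t _; rewrite lee_fin -mulrA -sqmodM; exact: sqmodD.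
rewrite esumD; first last.
- by move=> t _; rewrite lee_fin mulr_ge0 // sqmod_ge0.
- by move=> t _; rewrite lee_fin mulr_ge0 // sqmod_ge0.
by rewrite leeD // esumZ // => t; exact: sqmod_ge0.
Qed.

Lemma l2sum0 : l2sum 0 = 0%E.
Proof. by apply: esum1 => t _; rewrite /sqmod /= expr0n addr0. Qed.

Lemma l2_submod_closed : submod_closed l2_pred.
Proof.
split=> [|c x y /asboolP xl /asboolP yl].
  by apply/asboolP; rewrite l2sum0 ltry.
apply/asboolP; apply: le_lt_trans (l2sum_lin c x y) _.
have fin z : (l2sum z < +oo)%E -> l2sum z \is a fin_num.
  by move=> zl; rewrite ge0_fin_numE // l2sum_ge0.
by rewrite ltey_eq fin_numD !fin_numM ?fin.
Qed.

HB.instance Definition _ :=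
  GRing.isSubmodClosed.Build R[i] (T -> R[i]) l2_pred l2_submod_closed.

Record l2 := L2 { l2val :> T -> R[i]; l2P : l2val \in l2_pred }.

HB.instance Definition _ := [isSub for l2val].
HB.instance Definition _ := [Choice of l2 by <:].
HB.instance Definition _ := [SubChoice_isSubLmodule of l2 by <:].

Implicit Types x y : l2.

Definition inner x y : R[i] := csum (fun t => x t * (y t)^*).

Definition l2norm x : R := Num.sqrt (fine (l2sum x)).

Lemma l2_fin x : l2sum x \is a fin_num.
Proof. by rewrite ge0_fin_numE ?l2sum_ge0 //; exact/asboolP/l2P. Qed.

Lemma l2norm_ge0 x : 0 <= l2norm x. Proof. exact: sqrtr_ge0. Qed.

Lemma sqr_l2norm x : l2norm x ^+ 2 = fine (l2sum x).
Proof. by rewrite sqr_sqrtr // fine_ge0 // l2sum_ge0. Qed.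

Lemma l2norm_lin c x y :
  l2norm (c *: x + y) ^+ 2 <=
    2 * sqmod c * l2norm x ^+ 2 + 2 * l2norm y ^+ 2.
Proof.
rewrite !sqr_l2norm -lee_fin EFinD [X in (_ <= X + _)%E]EFinM.
rewrite [X in (_ <= _ + X)%E]EFinM !fineK ?l2_fin //; exact: l2sum_lin.
Qed.

Lemma l2_csummable x y : csummable (fun t => x t * (y t)^*).
Proof.
have s : rsummable (fun t => sqmod (x t) + sqmod (y t)).
  have sq z : l2_pred z -> rsummable (fun t => sqmod (z t)).
    move=> /asboolP; apply: le_lt_trans; apply: le_esum => t _ /=.
    by rewrite lee_fin ger0_norm // sqmod_ge0.
  by apply: (@summableD _ _ _ (EFin \o _) (EFin \o _)); apply: sq; exact: l2P.
split; apply: rsummable_le s => t; case: (x t) (y t) => a b [c d];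
  rewrite /sqmod /= ler_norml; apply/andP; split.
- by have := sqr_ge0 (a + c); have := sqr_ge0 (b + d); nra.
- by have := sqr_ge0 (a - c); have := sqr_ge0 (b - d); nra.
- by have := sqr_ge0 (b + c); have := sqr_ge0 (a - d); nra.
- by have := sqr_ge0 (b - c); have := sqr_ge0 (a + d); nra.
Qed.

Lemma innerD x x' y : inner (x + x') y = inner x y + inner x' y.
Proof.
rewrite /inner -csumD; [|exact: l2_csummable..].
by congr csum; apply/funext => t; rewrite -mulrDl.
Qed.

Lemma innerZl c x y : inner (c *: x) y = inner x (c^* *: y).
Proof.
congr csum; apply/funext => t.
rewrite -[(c *: x) t]/(c * x t) -[(_ *: y) t]/(c^* * y t).
by rewrite rmorphM /= conjCK mulrCA mulrA.
Qed.

Lemma inner0 y : inner 0 y = 0.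
Proof.
by rewrite -[RHS](csum0 R T); congr csum; apply/funext => t; rewrite mul0r.
Qed.

End L2.

Arguments l2 : clear implicits.

Section BoundedOperators.
Variables (R : realType) (T : choiceType).
Local Notation H := (l2 R T).

Definition bounded_op_pred : {pred H -> H} :=
  [pred A | `[< linear A /\
    exists M : R, forall x, l2norm (A x) <= M * l2norm x >]].

Lemma bounded_op_submod_closed : submod_closed bounded_op_pred.
Proof.
split=> [|c A B /asboolP[Al [M AM]] /asboolP[Bl [M' BM]]]; apply/asboolP.
  split=> [a u v|].
    by rewrite -[LHS]/(0 : H) -[RHS]/(a *: 0 + 0 : H) scaler0 addr0.
  exists 0 => x; rewrite mul0r.
  by rewrite /l2norm [l2sum _]l2sum0 /= sqrtr0.
split=> [a u v|].
  have E w : (c *: A + B) w = c *: A w + B w by [].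
  rewrite !E Al Bl !scalerDr !scalerA [c * a]mulrC.
  by rewrite !addrA; congr (_ + _); rewrite addrAC.
have le2 (C : H -> H) K x : l2norm (C x) <= K * l2norm x ->
    l2norm (C x) ^+ 2 <= K ^+ 2 * l2norm x ^+ 2.
  move=> CK; rewrite -exprMn ler_pXn2r // nnegrE ?l2norm_ge0 //.
  exact: le_trans (l2norm_ge0 _) CK.
pose K := 2 * sqmod c * M ^+ 2 + 2 * M' ^+ 2.
have K0 : 0 <= K.
  by rewrite /K; have := sqmod_ge0 c; have := sqr_ge0 M; have := sqr_ge0 M'; nra.
exists (Num.sqrt K) => x.
rewrite -(@ler_pXn2r _ 2) // ?nnegrE ?mulr_ge0 ?sqrtr_ge0 ?l2norm_ge0 //.
rewrite exprMn (sqr_sqrtr K0); apply: le_trans (l2norm_lin c (A x) (B x)) _.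
have := le2 _ _ _ (AM x); have := le2 _ _ _ (BM x).
have := sqmod_ge0 c; rewrite /K.
set a := l2norm (A x) ^+ 2; set b := l2norm (B x) ^+ 2.
set n := l2norm x ^+ 2; set s := sqmod c => s0 bn an.
have := ler_wpM2l s0 an; lra.
Qed.

HB.instance Definition _ := GRing.isSubmodClosed.Build
  R[i] (H -> H) bounded_op_pred bounded_op_submod_closed.

Record bounded_op :=
  BoundedOp { op_fun :> H -> H; opP : op_fun \in bounded_op_pred }.

HB.instance Definition _ := [isSub for op_fun].
HB.instance Definition _ := [Choice of bounded_op by <:].
HB.instance Definition _ := [SubChoice_isSubLmodule of bounded_op by <:].

Implicit Types A B C : bounded_op.

Lemma op_linear A : linear A. Proof. by have /asboolP[] := opP A. Qed.

HB.instance Definition _ A := GRing.isLinear.Build R[i] H H *:%R A (op_linear A).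

Lemma op_one_subproof : (id : H -> H) \in bounded_op_pred.
Proof. by apply/asboolP; split=> //; exists 1 => x; rewrite mul1r. Qed.

Lemma op_mul_subproof A B : (A \o B : H -> H) \in bounded_op_pred.
Proof.
apply/asboolP; split=> [c u v|]; first by rewrite /= !linearP.
have [/asboolP[_ [M AM]] /asboolP[_ [M' BM]]] := (opP A, opP B).
exists (`|M| * `|M'|) => x /=; apply: le_trans (AM _) _.
apply: (@le_trans _ _ (`|M| * l2norm (B x))).
  by rewrite ler_wpM2r ?l2norm_ge0 // ler_norm.
rewrite -mulrA ler_wpM2l //; apply: le_trans (BM _) _.
by rewrite ler_wpM2r ?l2norm_ge0 // ler_norm.
Qed.

Definition op_one := BoundedOp op_one_subproof.
Definition op_mul A B := BoundedOp (op_mul_subproof A B).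

Lemma op_eqP A B : A =1 B -> A = B.
Proof. by move=> AB; apply/val_inj/funext. Qed.

Lemma op_addE A B x : (A + B) x = A x + B x. Proof. by []. Qed.
Lemma op_oppE A x : (- A) x = - A x. Proof. by []. Qed.
Lemma op_scaleE c A x : (c *: A) x = c *: A x. Proof. by []. Qed.

Lemma op_mulA : associative op_mul.
Proof. by move=> A B C; exact: op_eqP. Qed.
Lemma op_mul1l : left_id op_one op_mul.
Proof. by move=> A; exact: op_eqP. Qed.
Lemma op_mul1r : right_id op_one op_mul.
Proof. by move=> A; exact: op_eqP. Qed.
Lemma op_mulDl : left_distributive op_mul +%R.
Proof. by move=> A B C; exact: op_eqP. Qed.
Lemma op_mulDr : right_distributive op_mul +%R.
Proof. by move=> A B C; apply: op_eqP => x; rewrite /= linearD. Qed.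

HB.instance Definition _ := GRing.Zmodule_isPzRing.Build bounded_op
  op_mulA op_mul1l op_mul1r op_mulDl op_mulDr.

Lemma op_mulE A B x : (A * B) x = A (B x). Proof. by []. Qed.
Lemma op_oneE x : (1 : bounded_op) x = x. Proof. by []. Qed.

(* Closure in the weak operator topology: a basic neighbourhood of [A] consists
   of the [B] such that |<(A - B) x, y>| < e for finitely many pairs (x, y). *)
Definition wot_closure (S : set bounded_op) : set bounded_op :=
  [set A | forall (s : seq (H * H)) (e : R), 0 < e ->
    exists2 B, S B & forall x y, (x, y) \in s ->
      `|inner ((A - B) x) y| < e%:C].

Lemma sub_wot_closure S : S `<=` wot_closure S.
Proof.
move=> A SA s e e0; exists A => // x y _.
by rewrite subrr inner0 normr0 ltcR.
Qed.

Lemma normC_split (z w : R[i]) (e : R) :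
  `|z| < (e / 2)%:C -> `|w| < (e / 2)%:C -> `|z + w| < e%:C.
Proof.
move=> zl wl; rewrite (splitr e) rmorphD.
exact: le_lt_trans (ler_normD z w) (ltrD zl wl).
Qed.

Lemma wot_closureK S A : wot_closure (wot_closure S) A -> wot_closure S A.
Proof.
move=> clA s e e0; have e20 : 0 < e / 2 by rewrite divr_gt0.
have [B clB AB] := clA s _ e20; have [C SC BC] := clB s _ e20.
exists C => // x y xys.
have -> : A - C = (A - B) + (B - C) by rewrite addrA subrK.
rewrite op_addE innerD.
exact: normC_split (AB x y xys) (BC x y xys).
Qed.

End BoundedOperators.

Section GroupVonNeumann.
Variables (R : realType) (gT : groupType).
Local Notation H := (l2 R gT).
Local Notation B := (bounded_op R gT).
Implicit Types (g h : gT) (x y : H) (S : set B).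

Lemma delta_subproof g : (fun h => (h == g)%:R : R[i]) \in @l2_pred R gT.
Proof.
apply/asboolP.
have -> : l2sum (fun h => (h == g)%:R : R[i]) =
    (\esum_(h in [set g]) (1 : R)%:E)%E.
  rewrite esum_mkcond; apply: eq_esum => h _.
  rewrite in_set1; case: (h == g); rewrite /sqmod /= ?expr1n expr0n ?addr0 //.
by rewrite esum_set1 // ltry.
Qed.

Definition delta g : H := L2 (delta_subproof g).

Lemma transl_bij g : bijective (fun h : gT => (g^-1 * h)%g).
Proof.
exists (fun h => (g * h)%g) => h; first by rewrite mulgA mulgV mul1g.
by rewrite mulgA mulVg mul1g.
Qed.

Lemma l2sum_transl g (x : gT -> R[i]) :
  l2sum (fun h => x (g^-1 * h)%g) = l2sum x.
Proof.
have b := transl_bij g; rewrite -setTT_bijective in b.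
by rewrite /l2sum [RHS](reindex_esum _ _ _ _ b).
Qed.

Lemma transl_subproof g x : (fun h => x (g^-1 * h)%g) \in @l2_pred R gT.
Proof. by apply/asboolP; rewrite l2sum_transl; exact/asboolP/l2P. Qed.

Definition transl g x : H := L2 (transl_subproof g x).

Lemma lreg_subproof g : transl g \in @bounded_op_pred R gT.
Proof.
apply/asboolP; split=> [c x y|]; first exact: val_inj.
by exists 1 => x; rewrite mul1r /l2norm l2sum_transl.
Qed.

Definition lreg g : B := BoundedOp (lreg_subproof g).

Lemma lregE g x h : lreg g x h = x (g^-1 * h)%g. Proof. by []. Qed.

Lemma lregM g h : lreg (g * h)%g = lreg g * lreg h.
Proof.
apply: op_eqP => x; apply: val_inj; apply/funext => k.
by rewrite /= invgM mulgA.
Qed.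

Lemma lreg1 : lreg 1%g = 1.
Proof.
by apply: op_eqP => x; apply: val_inj; apply/funext => k; rewrite /= invg1 mul1g.
Qed.

Lemma inner_lreg g x y : inner (lreg g x) y = inner x (lreg g^-1%g y).
Proof.
rewrite /inner -(csum_reindex _ (transl_bij g^-1%g)); congr csum.
by apply/funext => h; rewrite /= !invgK mulgA mulVg mul1g.
Qed.

Lemma lreg_delta g h : lreg g (delta h) = delta (g * h)%g.
Proof.
apply: val_inj; apply/funext => k /=.
by rewrite (can2_eq (mulVKg g) (mulKg g)).
Qed.

(* C[gT] inside the bounded operators: the span of the left translations. *)
Definition group_algebra : set B :=
  [set A | exists s : seq (R[i] * gT), A = \sum_(p <- s) p.1 *: lreg p.2].

Definition vN_pred : {pred B} := [pred A | `[< wot_closure group_algebra A >]].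

Lemma group_algebraD A C :
  group_algebra A -> group_algebra C -> group_algebra (A + C).
Proof. by move=> [s ->] [t ->]; exists (s ++ t); rewrite big_cat. Qed.

Lemma group_algebraZ c A : group_algebra A -> group_algebra (c *: A).
Proof.
move=> [s ->]; exists [seq (c * p.1, p.2) | p <- s].
by rewrite big_map scaler_sumr; apply: eq_bigr => p _; rewrite scalerA.
Qed.

Lemma lregZr g c A : lreg g * (c *: A) = c *: (lreg g * A).
Proof. by apply: op_eqP => x; rewrite op_mulE !op_scaleE linearZ. Qed.

Lemma group_algebra_lreg g A : group_algebra A -> group_algebra (lreg g * A).
Proof.
move=> [s ->]; exists [seq (p.1, (g * p.2)%g) | p <- s].
by rewrite big_map mulr_sumr; apply: eq_bigr => p _; rewrite lregM lregZr.
Qed.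

Lemma lreg_group_algebra g : group_algebra (lreg g).
Proof. by exists [:: (1, g)]; rewrite big_seq1 scale1r. Qed.

Lemma vN_D A C : A \in vN_pred -> C \in vN_pred -> A + C \in vN_pred.
Proof.
move=> /asboolP clA /asboolP clC; apply/asboolP => s e e0.
have e20 : 0 < e / 2 by rewrite divr_gt0.
have [A' gA AA] := clA s _ e20; have [C' gC CC] := clC s _ e20.
exists (A' + C'); first exact: group_algebraD.
move=> x y xys; rewrite opprD addrACA op_addE innerD.
exact: normC_split (AA x y xys) (CC x y xys).
Qed.

Lemma vN_Z c A : A \in vN_pred -> c *: A \in vN_pred.
Proof.
move=> /asboolP clA; apply/asboolP => s e e0.
have [A' gA AA] := clA [seq (p.1, c^* *: p.2) | p <- s] _ e0.
exists (c *: A'); first exact: group_algebraZ.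
move=> x y xys; rewrite -scalerBr op_scaleE innerZl AA //.
by apply/mapP; exists (x, y).
Qed.

Lemma vN_lregM g A : A \in vN_pred -> lreg g * A \in vN_pred.
Proof.
move=> /asboolP clA; apply/asboolP => s e e0.
have [A' gA AA] := clA [seq (p.1, lreg g^-1%g p.2) | p <- s] _ e0.
exists (lreg g * A'); first exact: group_algebra_lreg.
move=> x y xys; rewrite -mulrBr op_mulE inner_lreg AA //.
by apply/mapP; exists (x, y).
Qed.

Lemma vN_lreg g : lreg g \in vN_pred.
Proof. by apply/asboolP/sub_wot_closure/lreg_group_algebra. Qed.

Lemma vN_submod_closed : submod_closed vN_pred.
Proof.
split; last by move=> c A C vA vC; exact: vN_D (vN_Z c vA) vC.
have g0 : group_algebra 0 by exists [::]; rewrite big_nil.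
by apply/asboolP; exact: (sub_wot_closure g0).
Qed.

HB.instance Definition _ := GRing.isSubmodClosed.Build
  R[i] B vN_pred vN_submod_closed.

Lemma vN_mulr_closed : GRing.mulr_closed vN_pred.
Proof.
split=> [|A C vA vC]; first by rewrite -lreg1 vN_lreg.
apply/asboolP/wot_closureK => s e e0.
have /asboolP clA := vA.
have [A' [t ->] AA] := clA [seq (C p.1, p.2) | p <- s] _ e0.
exists ((\sum_(p <- t) p.1 *: lreg p.2) * C).
  suff /asboolP : (\sum_(p <- t) p.1 *: lreg p.2) * C \in vN_pred by [].
  rewrite mulr_suml; apply: rpred_sum => p _.
  have -> : (p.1 *: lreg p.2) * C = p.1 *: (lreg p.2 * C) by exact: op_eqP.
  exact: vN_Z (vN_lregM _ vC).
move=> x y xys; rewrite -mulrBl op_mulE AA //.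
by apply/mapP; exists (x, y).
Qed.

HB.instance Definition _ := GRing.isMulClosed.Build B vN_pred vN_mulr_closed.

(* L(gT): the weak operator closure of C[gT], as a type with its algebra
   structure (product = composition of operators). *)
Record vN := VN { vN_op :> B; vNP : vN_op \in vN_pred }.

HB.instance Definition _ := [isSub for vN_op].
HB.instance Definition _ := [Choice of vN by <:].
HB.instance Definition _ := [SubChoice_isSubLmodule of vN by <:].
HB.instance Definition _ :=
  GRing.SubZmodule_isSubPzRing.Build B vN_pred vN (subringClosedP _).

(* The identification of [g] with the unitary [lreg g] of L(gT). *)
Definition vNu g : vN := VN (vN_lreg g).

(* The coefficient t_g of [A] in L(gT), formally A = \sum_g t_g g, where the
   family (t_g) is by definition A applied to the basis vector [delta 1]. *)
Definition vN_coef (A : vN) g : R[i] := A (delta 1%g) g.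

Definition vN_trace (A : vN) : R[i] := vN_coef A 1%g.

Lemma vN_coef_sum (s : seq gT) (t : gT -> R[i]) g : uniq s ->
  vN_coef (\sum_(h <- s) t h *: vNu h) g = if g \in s then t g else 0.
Proof.
elim: s => [|h s IH] /=; first by rewrite big_nil.
case/andP=> hs us; rewrite big_cons.
have -> : vN_coef (t h *: vNu h + \sum_(k <- s) t k *: vNu k) g =
    t h * (g == h)%:R + vN_coef (\sum_(k <- s) t k *: vNu k) g.
  by rewrite -[in RHS](inj_eq (mulgI h^-1%g)) mulVg.
rewrite IH // in_cons; case: eqVneq => [->|_] /=; last by rewrite mulr0 add0r.
by rewrite (negPf hs) mulr1 addr0.
Qed.

End GroupVonNeumann.

Arguments vN : clear implicits.
Arguments vNu R {gT} g.

Notation LF R N := (vN R (freeGroup N)).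

Definition Gsum (R : realType) (N : nat) : LF R N :=
  \sum_(i < N) vNu R (fg_gen i) + \sum_(i < N) vNu R (fg_gen i)^-1%g.

(* [diagram N r] is the row of superscript [r + 2]; its entry [j] stands for
   p_j^{r+2} ([r] even) or q_j^{r+2} ([r] odd). Only the entries with [j <= r]
   of the same parity as [r] are meaningful. *)
Fixpoint diagram (N r j : nat) : nat :=
  (if r is r'.+1 then
    if j == r then (2 * N - 1) + diagram N r' r'
    else if j == 0 then 2 * N * diagram N r' 1
    else (2 * N - 1) * diagram N r' j.+1 + diagram N r' j.-1
  else 2 * N)%N.

Lemma diagramS N r j : (diagram N r.+1 j =
  if j == r.+1 then (2 * N - 1) + diagram N r r
  else if j == 0 then 2 * N * diagram N r 1
  else (2 * N - 1) * diagram N r j.+1 + diagram N r j.-1)%N.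
Proof. by []. Qed.

Definition p_ (N n j : nat) : nat := diagram N (n - 2)%N j.
Definition q_ (N n i : nat) : nat := diagram N (n - 2)%N i.

Section Recurrence.
Local Open Scope nat_scope.
Variable N : nat.

Lemma p_2_0 : p_ N 2 0 = 2 * N. Proof. by []. Qed.

Lemma q_3_1 : q_ N 3 1 = (2 * N - 1) + 2 * N. Proof. by []. Qed.

Variable k : nat.
Hypothesis k_ge2 : 2 <= k.

Lemma p_top :
  p_ N (2 * k) (2 * k - 2) = (2 * N - 1) + q_ N (2 * k - 1) (2 * k - 3).
Proof.
by case: k k_ge2 => [|[|m]] // _; rewrite !mulnS /p_ /q_ /= eqxx.
Qed.

Lemma p_mid i : 1 <= i <= k - 2 ->
  p_ N (2 * k) (2 * i) =
    (2 * N - 1) * q_ N (2 * k - 1) (2 * i + 1) + q_ N (2 * k - 1) (2 * i - 1).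
Proof.
case: k k_ge2 => [|[|m]] // _ /andP[i1 im]; rewrite /p_ /q_.
have -> : 2 * m.+2 - 2 = (2 * m).+2 by lia.
have -> : 2 * m.+2 - 1 - 2 = (2 * m).+1 by lia.
rewrite [LHS]diagramS ifF; last lia.
rewrite ifF; last lia.
by rewrite addn1 (subn1 (2 * i)).
Qed.

Lemma p_bot : p_ N (2 * k) 0 = 2 * N * q_ N (2 * k - 1) 1.
Proof.
case: k k_ge2 => [|[|m]] // _; rewrite /p_ /q_.
have -> : 2 * m.+2 - 2 = (2 * m).+2 by lia.
by have -> : 2 * m.+2 - 1 - 2 = (2 * m).+1 by lia.
Qed.

Lemma q_top :
  q_ N (2 * k + 1) (2 * k - 1) = (2 * N - 1) + p_ N (2 * k) (2 * k - 2).
Proof.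
case: k k_ge2 => [|[|m]] // _; rewrite /p_ /q_.
have -> : 2 * m.+2 + 1 - 2 = (2 * m).+3 by lia.
have -> : 2 * m.+2 - 2 = (2 * m).+2 by lia.
have -> : 2 * m.+2 - 1 = (2 * m).+3 by lia.
by rewrite [LHS]diagramS eqxx.
Qed.

Lemma q_mid i : 0 <= i <= k - 2 ->
  q_ N (2 * k + 1) (2 * i + 1) =
    (2 * N - 1) * p_ N (2 * k) (2 * i + 2) + p_ N (2 * k) (2 * i).
Proof.
case: k k_ge2 => [|[|m]] // _ im; rewrite /p_ /q_.
have -> : 2 * m.+2 + 1 - 2 = (2 * m).+3 by lia.
have -> : 2 * m.+2 - 2 = (2 * m).+2 by lia.
have -> : 2 * i + 2 = (2 * i).+2 by lia.
by rewrite addn1 [LHS]diagramS; case: eqP => //; lia.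
Qed.

End Recurrence.

(* Main.v *)
Require Import Defs.
From mathcomp Require Import all_boot all_order all_algebra.
From mathcomp Require Import all_classical all_reals all_analysis.
From mathcomp Require Import complex.
From mathcomp Require Import zify.

Import GRing.Theory.
Local Open Scope ring_scope.

(** The coefficient of [G^n] at a group element [h] depends only on the length
    of [h]: left multiplication by the [2N] letters sends the unit to elements of
    length 1, and an element of length [l > 0] once to length [l - 1] and [2N - 1]
    times to length [l + 1]. The resulting recurrence in [n] for these radial
    coefficients is the recurrence diagram, except that the diagram omits the
    coefficient 1 at length [n]. *)

Fixpoint radial_coef (N n l : nat) : nat :=
  if n is m.+1 then
    if l is k.+1 then
      ((2 * N - 1) * radial_coef N m k.+2 + radial_coef N m k)%N
    else (2 * N * radial_coef N m 1)%N
  else l == 0%N.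

Lemma radial_coef_gt N n l : (n < l)%N -> radial_coef N n l = 0%N.
Proof.
elim: n l => [|n IH] [|l] //= nl.
by rewrite !IH ?muln0 //; lia.
Qed.

Lemma radial_coef_diag N n : radial_coef N n n = 1%N.
Proof. by elim: n => //= n ->; rewrite radial_coef_gt ?muln0. Qed.

(** Multiplying by a letter changes the length by one, hence flips its parity. *)
Lemma radial_coef_parity N n l : odd n != odd l -> radial_coef N n l = 0%N.
Proof.
by elim: n l => [|n IH] [|l] //= nl; rewrite !IH ?muln0 //=; lia.
Qed.

Lemma diagram_radial_coef N r j : (j <= r)%N -> odd r = odd j ->
  diagram N r j = radial_coef N r.+2 j.
Proof.
elim: r j => [|r IH] j jr odd_rj.
  by case: j jr {odd_rj} => //=; rewrite muln0 muln1.
rewrite diagramS; have [->|jr1] := eqVneq j r.+1.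
  (* The omitted diagonal coefficient 1 at length [r.+2] gives the bare summand [2 * N - 1]. *)
  rewrite IH // -[RHS]/((2 * N - 1) * radial_coef N r.+2 r.+2
    + radial_coef N r.+2 r)%N.
  by rewrite radial_coef_diag muln1.
case: j jr odd_rj jr1 => [|j] jr odd_rj jr1.
  by rewrite /= IH //; lia.
rewrite -[RHS]/((2 * N - 1) * radial_coef N r.+2 j.+2
  + radial_coef N r.+2 j)%N.
(* Here [j < r] have equal parity, so [j.+2 <= r] and both instances of [IH] apply. *)
by rewrite !IH //; lia.
Qed.

(** Only the inverse of the first letter of [w] cancels; every other letter lengthens the word. *)
Lemma sum_letter_lact N (F : nat -> nat) (w : seq (letter N)) :
  (\sum_(a : letter N) F (size (lact a w)) =
   if size w is k.+1 then (2 * N - 1) * F k.+2 + F k else 2 * N * F 1)%N.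
Proof.
have card_letter : #|{: letter N}| = (2 * N)%N.
  by rewrite card_prod card_ord card_bool mulnC.
case: w => [|b w] /=; first by rewrite sum_nat_const card_letter.
rewrite (bigD1 (linv b)) //= linvK eqxx addnC; congr (_ + _)%N.
rewrite (eq_bigr (fun=> F (size w).+2)) => [|a ab]; last first.
  by case: eqP => // ba; rewrite ba linvK eqxx in ab.
rewrite sum_nat_const; congr (_ * _)%N.
by rewrite (cardC1 (linv b)) card_letter subn1.
Qed.

Lemma vN_coefD (R : realType) (gT : groupType) (A B : vN R gT) h :
  vN_coef (A + B) h = vN_coef A h + vN_coef B h.
Proof. by []. Qed.

Lemma vN_coef_bigsum (R : realType) (gT : groupType) (I : finType)
    (A : I -> vN R gT) h :
  vN_coef (\sum_i A i) h = \sum_i vN_coef (A i) h.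
Proof. exact: (big_morph (fun A => vN_coef A h)). Qed.

Lemma vN_coef_lmul (R : realType) (gT : groupType) (A : vN R gT) g h :
  vN_coef (vNu R g * A) h = vN_coef A (g^-1 * h)%g.
Proof. by []. Qed.

Lemma vN_coef_Gsum_exp (R : realType) (N n : nat) (h : freeGroup N) :
  vN_coef (Gsum R N ^+ n : LF R N) h = (radial_coef N n (size (word h)))%:R.
Proof.
elim: n h => [|n IH] h.
  rewrite expr0 -[LHS]/((h == 1%g)%:R : R[i]) -val_eqE /=.
  by case: (word h).
rewrite exprS mulrDl !mulr_suml vN_coefD !vN_coef_bigsum.
have -> : radial_coef N n.+1 (size (word h)) =
    (\sum_(a : letter N) radial_coef N n (size (lact a (word h))))%N.
  by rewrite sum_letter_lact; case: (word h).
rewrite natr_sum -big_split /=.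
rewrite (eq_bigr (fun i => \sum_(b : bool)
    (radial_coef N n (size (lact (i, b) (word h))))%:R)) => [|i _]; last first.
  (* The coefficient of [g * A] at [h] is read at [g^-1 * h], so the generator contributes the
     letter [(i, true)] and its inverse contributes [(i, false)]. *)
  by rewrite big_bool !vN_coef_lmul !IH.
by rewrite pair_bigA; apply: eq_bigr => -[].
Qed.

Theorem theorem1p2 (R : realType) (N : nat) (hN : (1 <= N)%N)
    (n : nat) (hn : (1 <= n)%N) :
  vN_trace (Gsum R N ^+ n : LF R N) =
    if odd n then 0 else ((p_ N n 0)%:R : R[i]).
Proof.
rewrite /vN_trace vN_coef_Gsum_exp /=; case: ifPn => n_odd.
  by rewrite radial_coef_parity ?n_odd.
(* A positive even [n] is at least 2, so the truncated [n - 2] in [p_] is exact. *)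
case: n hn n_odd => [|[|n]] // _ n_even.
rewrite /p_ !subSS subn0 diagram_radial_coef //=.
by apply/negbTE; move: n_even; rewrite /= negbK.
Qed.
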